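(* Let $A,G,\Gamma,\Gamma_f\in\mathbb R^{n\times n}$, $B\in\mathbb R^{n\times n_1}$, $D\in\mathbb R^{n\times n_2}$, $D_0\in\mathbb R^{n\times n_3}$, $\eta,\eta_f\in\mathbb R^n$, let $Q\ge0$, $Q_f\ge0$ be symmetric $n\times n$ matrices, $R>0$ a symmetric $n_1\times n_1$ matrix, and $T>0$. Then the ODE system $$\begin{aligned} \dot P=&-A^TP-PA+PBR^{-1}B^TP-Q,\\ \dot\Lambda=&-(\Lambda+H)BR^{-1}B^T(\Lambda+H^T)-\Lambda[A+G-BR^{-1}B^T(P+\Lambda+H+H^T)]\\ &-[A+G-BR^{-1}B^T(P+\Lambda+H+H^T)]^T\Lambda+H^TBR^{-1}B^TH-H^TG-G^TH-\Gamma^TQ\Gamma,\\ \dot H=&-A^TH+PBR^{-1}B^TH-H[A+G-BR^{-1}B^T(P+\Lambda+H+H^T)]-PG+Q\Gamma,\\ \dot S=&-A^TS+PBR^{-1}B^TS+HBR^{-1}B^T(S+\theta)+Q\eta,\\ \dot\theta=&\ H^TBR^{-1}B^TS+\Lambda BR^{-1}B^T(S+\theta)-[A+G-BR^{-1}B^T(P+\Lambda+H+H^T)]^T\theta\\ &-(\Lambda+H)BR^{-1}B^T\theta-G^TS-\Gamma^TQ\eta,\\ \dot r=&\ S^TBR^{-1}B^TS+\theta^TBR^{-1}B^T(2S+\theta)-{\rm Tr}[(P+\Lambda+H+H^T)D_0D_0^T]-{\rm Tr}(PDD^T)-\eta^TQ\eta, \end{aligned}$$ with terminal conditions $P(T)=Q_f$,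 $\Lambda(T)=\Gamma_f^TQ_f\Gamma_f$, $H(T)=-Q_f\Gamma_f$, $S(T)=-Q_f\eta_f$, $\theta(T)=\Gamma_f^TQ_f\eta_f$, $r(T)=\eta_f^TQ_f\eta_f$, has a unique solution $(P,\Lambda,H,S,\theta,r)$ on $[0,T]$.
   Context: The unknowns are functions of $t\in[0,T]$: $P,\Lambda,H$ are $\mathbb R^{n\times n}$-valued (with $P$ and $\Lambda$ symmetric), $S,\theta$ are $\mathbb R^n$-valued and $r$ is real-valued. *)

(* Defs.v *)
From HB Require Import structures.
From mathcomp Require Import all_boot all_order all_algebra.
From mathcomp Require Import all_classical all_reals all_analysis.

Set Implicit Arguments.
Unset Strict Implicit.
Unset Printing Implicit Defensive.

Import Order.TTheory GRing.Theory Num.Theory.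
Import numFieldNormedType.Exports.

Local Open Scope classical_set_scope.
Local Open Scope ring_scope.

(* u^T M v; the 1 x 1 product is read as a real number. *)
Definition bilin (K : realType) (n : nat) (u : 'cV[K]_n) (M : 'M[K]_n)
    (v : 'cV[K]_n) : K :=
  (u^T *m M *m v) 0 0.

Definition sym_psd (K : realType) (n : nat) (M : 'M[K]_n) : Prop :=
  M \is symmetricmx /\ forall x : 'cV[K]_n, 0 <= bilin x M x.

Definition sym_pd (K : realType) (n : nat) (M : 'M[K]_n) : Prop :=
  M \is symmetricmx /\ forall x : 'cV[K]_n, x != 0 -> 0 < bilin x M x.

(* f is differentiable at t relative to `[0, T], with derivative l: two-sided
   for 0 < t < T, one-sided at t = 0 and t = T.  Only the values of f on
   `[0, T] matter. *)
Definition has_deriv_on (K : realType) (m n : nat) (T : K)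
    (f : K -> 'M[K]_(m, n)) (t : K) (l : 'M[K]_(m, n)) : Prop :=
  (fun s => (s - t)^-1 *: (f s - f t)) @ within `[0, T] t^' --> l.

Definition has_deriv_on_real (K : realType) (T : K)
    (f : K -> K) (t : K) (l : K) : Prop :=
  (fun s => (s - t)^-1 * (f s - f t)) @ within `[0, T] t^' --> l.

Section RightHandSides.

Variables (K : realType) (n n1 n2 n3 : nat).
Variables (A G Gam : 'M[K]_n) (B : 'M[K]_(n, n1)) (D : 'M[K]_(n, n2))
  (D0 : 'M[K]_(n, n3)) (eta : 'cV[K]_n) (Q : 'M[K]_n) (R : 'M[K]_n1).
Variables (P Lam H : 'M[K]_n) (S theta : 'cV[K]_n).

Definition BRB : 'M[K]_n := B *m invmx R *m B^T.

Definition Acl : 'M[K]_n := A + G - BRB *m (P + Lam + H + H^T).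

Definition rhs_P : 'M[K]_n :=
  - (A^T *m P) - P *m A + P *m BRB *m P - Q.

Definition rhs_Lam : 'M[K]_n :=
  - ((Lam + H) *m BRB *m (Lam + H^T)) - Lam *m Acl - Acl^T *m Lam
  + H^T *m BRB *m H - H^T *m G - G^T *m H - Gam^T *m Q *m Gam.

Definition rhs_H : 'M[K]_n :=
  - (A^T *m H) + P *m BRB *m H - H *m Acl - P *m G + Q *m Gam.

Definition rhs_S : 'cV[K]_n :=
  - (A^T *m S) + P *m BRB *m S + H *m BRB *m (S + theta) + Q *m eta.

Definition rhs_theta : 'cV[K]_n :=
  H^T *m BRB *m S + Lam *m BRB *m (S + theta) - Acl^T *m theta
  - (Lam + H) *m BRB *m theta - G^T *m S - Gam^T *m Q *m eta.

Definition rhs_r : K :=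
  bilin S BRB S + bilin theta BRB (2 *: S + theta)
  - \tr ((P + Lam + H + H^T) *m D0 *m D0^T) - \tr (P *m D *m D^T)
  - bilin eta Q eta.

End RightHandSides.

Record is_solution (K : realType) (n n1 n2 n3 : nat)
    (A G Gam Gamf : 'M[K]_n) (B : 'M[K]_(n, n1)) (D : 'M[K]_(n, n2))
    (D0 : 'M[K]_(n, n3)) (eta etaf : 'cV[K]_n) (Q Qf : 'M[K]_n)
    (R : 'M[K]_n1) (T : K)
    (P Lam H : K -> 'M[K]_n) (S theta : K -> 'cV[K]_n) (r : K -> K) : Prop :=
  IsSolution {
    sol_symP : forall t, 0 <= t <= T -> P t \is symmetricmx;
    sol_symLam : forall t, 0 <= t <= T -> Lam t \is symmetricmx;
    sol_P : forall t, 0 <= t <= T ->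
      has_deriv_on T P t (rhs_P A B Q R (P t));
    sol_Lam : forall t, 0 <= t <= T ->
      has_deriv_on T Lam t (rhs_Lam A G Gam B Q R (P t) (Lam t) (H t));
    sol_H : forall t, 0 <= t <= T ->
      has_deriv_on T H t (rhs_H A G Gam B Q R (P t) (Lam t) (H t));
    sol_S : forall t, 0 <= t <= T ->
      has_deriv_on T S t (rhs_S A B eta Q R (P t) (H t) (S t) (theta t));
    sol_theta : forall t, 0 <= t <= T ->
      has_deriv_on T theta t
        (rhs_theta A G Gam B eta Q R (P t) (Lam t) (H t) (S t) (theta t));
    sol_r : forall t, 0 <= t <= T ->
      has_deriv_on_real T r t
        (rhs_r B D D0 eta Q R (P t) (Lam t) (H t) (S t) (theta t));
    sol_PT : P T = Qf;
    sol_LamT : Lam T = Gamf^T *m Qf *m Gamf;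
    sol_HT : H T = - (Qf *m Gamf);
    sol_ST : S T = - (Qf *m etaf);
    sol_thetaT : theta T = Gamf^T *m Qf *m etaf;
    sol_rT : r T = bilin etaf Qf etaf
  }.

(* Main.v *)
Require Import Defs.
From HB Require Import structures.
From mathcomp Require Import all_boot all_order all_algebra.
From mathcomp Require Import all_classical all_reals all_analysis.
From mathcomp Require Import ring lra.

(** Write [M = B R^-1 B^T].  The matrix [Pi = P + Lam + H + H^T] solves a Riccati
    equation of its own, with [A + G] and [(1 - Gam)^T Q (1 - Gam)] in place of
    [A] and [Q], and [phi = S + theta] solves a linear equation whose coefficient
    is [A + G - M Pi].  Once [P] and [Pi] are known, [H], [phi], [S] and [r] are
    obtained one after the other from linear equations and quadratures, and
    [Lam], [theta] are recovered by subtraction.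

    A Riccati equation with semidefinite data is solved by [P = Y X^-1], where
    [(X, Y)] solves the linear Hamiltonian system; [X] stays invertible because
    [(X v)^T (Y v)] is monotone.  Moreover [X] is a fundamental matrix of
    [A - M P], which solves the remaining linear equations by variation of
    constants.  Uniqueness always reduces to Gronwall's inequality. *)

Set Implicit Arguments.
Unset Strict Implicit.
Unset Printing Implicit Defensive.

Import Order.TTheory GRing.Theory Num.Theory.
Import numFieldNormedType.Exports.

Local Open Scope classical_set_scope.
Local Open Scope ring_scope.

(** * Limits of matrix-valued functions *)

Section MatrixLimits.
Variables (K : realType) (U : Type) (F : set_system U).
Hypothesis FF : Filter F.

(** A neighbourhood of a matrix contains a product of neighbourhoods of its finitely many entries,
    and a filter is stable under finite intersections. Every limit rule below thus reduces to the
    scalar one. *)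
Lemma cvg_mxP (m n : nat) (f : U -> 'M[K]_(m, n)) (L : 'M[K]_(m, n)) :
  f @ F --> L <-> forall i j, (fun u => f u i j) @ F --> L i j.
Proof.
split=> [fL i j|fL].
  have := @cvg_comp _ _ _ f (fun M : 'M[K]_(m, n) => M i j) F (nbhs L) (nbhs (L i j)) fL.
  by apply; exact: coord_continuous.
move=> A [P LP sPA]; rewrite /nbhs /=.
apply: (@filterS _ F _ (fun u => forall ij : 'I_m * 'I_n, P ij.1 ij.2 (f u ij.1 ij.2))).
  by move=> u Pu; apply: sPA => i j; exact: (Pu (i, j)).
by apply: filter_forall => ij; exact: fL (LP ij.1 ij.2).
Qed.

Lemma cvg_addmx (m n : nat) (f g : U -> 'M[K]_(m, n)) (a b : 'M[K]_(m, n)) :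
  f @ F --> a -> g @ F --> b -> (fun u => f u + g u) @ F --> a + b.
Proof.
move=> /cvg_mxP fa /cvg_mxP gb; apply/cvg_mxP => i j; rewrite mxE.
by under eq_fun do rewrite mxE; exact: cvgD.
Qed.

Lemma cvg_scalemx (m n : nat) (k : U -> K) (f : U -> 'M[K]_(m, n)) (c : K)
    (a : 'M[K]_(m, n)) :
  k @ F --> c -> f @ F --> a -> (fun u => k u *: f u) @ F --> c *: a.
Proof.
move=> kc /cvg_mxP fa; apply/cvg_mxP => i j; rewrite mxE.
by under eq_fun do rewrite mxE; exact: cvgM.
Qed.

Lemma cvg_oppmx (m n : nat) (f : U -> 'M[K]_(m, n)) (a : 'M[K]_(m, n)) :
  f @ F --> a -> (fun u => - f u) @ F --> - a.
Proof.
move=> /cvg_mxP fa; apply/cvg_mxP => i j; rewrite mxE.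
by under eq_fun do rewrite mxE; exact: cvgN.
Qed.

Lemma cvg_trmx (m n : nat) (f : U -> 'M[K]_(m, n)) (a : 'M[K]_(m, n)) :
  f @ F --> a -> (fun u => (f u)^T) @ F --> a^T.
Proof.
move=> /cvg_mxP fa; apply/cvg_mxP => i j; rewrite mxE.
by under eq_fun do rewrite mxE; exact: fa.
Qed.

Lemma cvg_sumr (I : Type) (r : seq I) (P : pred I) (f : I -> U -> K) (a : I -> K) :
  (forall i, f i @ F --> a i) ->
  (fun u => \sum_(i <- r | P i) f i u) @ F --> \sum_(i <- r | P i) a i.
Proof. by move=> fa; apply: cvg_big => //; exact: add_continuous. Qed.

Lemma cvg_prodr (I : Type) (r : seq I) (P : pred I) (f : I -> U -> K) (a : I -> K) :
  (forall i, f i @ F --> a i) ->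
  (fun u => \prod_(i <- r | P i) f i u) @ F --> \prod_(i <- r | P i) a i.
Proof. by move=> fa; apply: cvg_big => //; exact: mul_continuous. Qed.

Lemma cvg_mulmx (m n p : nat) (f : U -> 'M[K]_(m, n)) (g : U -> 'M[K]_(n, p))
    (a : 'M[K]_(m, n)) (b : 'M[K]_(n, p)) :
  f @ F --> a -> g @ F --> b -> (fun u => f u *m g u) @ F --> a *m b.
Proof.
move=> /cvg_mxP fa /cvg_mxP gb; apply/cvg_mxP => i j; rewrite mxE.
under eq_fun do rewrite mxE.
by apply: cvg_sumr => k; exact: cvgM.
Qed.

Lemma cvg_det (n : nat) (f : U -> 'M[K]_n) (a : 'M[K]_n) :
  f @ F --> a -> (fun u => \det (f u)) @ F --> \det a.
Proof.
move=> /cvg_mxP fa; apply: cvg_sumr => s; apply: cvgM; first exact: cvg_cst.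
exact: cvg_prodr.
Qed.

Lemma cvg_adjmx (n : nat) (f : U -> 'M[K]_n) (a : 'M[K]_n) :
  f @ F --> a -> (fun u => \adj (f u)) @ F --> \adj a.
Proof.
move=> /cvg_mxP fa; apply/cvg_mxP => i j; rewrite mxE.
under eq_fun do rewrite mxE.
apply: cvgM; first exact: cvg_cst.
apply: cvg_det; apply/cvg_mxP => k l; rewrite !mxE.
by under eq_fun do rewrite !mxE; exact: fa.
Qed.

Lemma cvg_invmx (n : nat) (f : U -> 'M[K]_n) (a : 'M[K]_n) :
  a \in unitmx -> f @ F --> a -> (fun u => invmx (f u)) @ F --> invmx a.
Proof.
move=> aU fa; have a0 : \det a != 0 by rewrite -unitfE -unitmxE.
have fda := cvg_det fa.
(* [invmx] returns its argument when that is singular, so Cramer's formula is available only where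
   the determinant is nonzero, which holds eventually by continuity of [\det]. *)
have fU : \forall u \near F, (\det (f u))^-1 *: \adj (f u) = invmx (f u).
  near=> u; rewrite /invmx ifT// unitmxE unitfE; near: u.
  exact: (cvgr_neq0 _ fda).
apply: cvg_trans (near_eq_cvg fU) _.
rewrite /invmx aU; apply: cvg_scalemx; last exact: cvg_adjmx.
exact: cvgV.
Unshelve. all: by end_near. Qed.

End MatrixLimits.

(** * Differentiation rules relative to the interval *)

Section DerivativeRules.
Variables (K : realType) (T : K).

Lemma has_deriv_on_mxP (m n : nat) (f : K -> 'M[K]_(m, n)) (t : K) (l : 'M[K]_(m, n)) :
  has_deriv_on T f t l <->
  forall i j, has_deriv_on_real T (fun s => f s i j) t (l i j).
Proof.
split=> [/cvg_mxP fl i j|fl].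
  by have := fl i j; under eq_fun do rewrite !mxE.
apply/cvg_mxP => i j; have := fl i j.
by under [in X in _ -> X]eq_fun do rewrite !mxE.
Qed.

Lemma has_deriv_on_cvg (m n : nat) (f : K -> 'M[K]_(m, n)) (t : K) (l : 'M[K]_(m, n)) :
  has_deriv_on T f t l -> f @ within `[0, T] t^' --> f t.
Proof.
move=> fl.
(* On the punctured neighbourhood, [f s] is recovered from its difference quotient; the factor
   [s - t] then kills the quotient in the limit. *)
have e : \forall s \near within `[0, T] t^',
    (s - t) *: ((s - t)^-1 *: (f s - f t)) + f t = f s.
  apply: cvg_within; apply: (@filterS _ _ _ (fun s => s != t)).
    by move=> s st; rewrite scalerA divff ?subr_eq0// scale1r subrK.
  exact: withinT.
suff : (fun s => (s - t) *: ((s - t)^-1 *: (f s - f t)) + f t)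
    @ within `[0, T] t^' --> (t - t) *: l + f t.
  by rewrite subrr scale0r add0r => h; apply: cvg_trans h; exact: near_eq_cvg.
apply: cvg_addmx; last exact: cvg_cst.
apply: cvg_scalemx => //; apply: cvgB; last exact: cvg_cst.
by apply: cvg_within_filter; apply: cvg_within_filter; exact: cvg_id.
Qed.

Lemma has_deriv_on_cst (m n : nat) (a : 'M[K]_(m, n)) (t : K) :
  has_deriv_on T (fun=> a) t 0.
Proof.
rewrite /has_deriv_on; under eq_fun do rewrite subrr scaler0.
exact: cvg_cst.
Qed.

Lemma has_deriv_on_add (m n : nat) (f g : K -> 'M[K]_(m, n)) (t : K)
    (a b : 'M[K]_(m, n)) :
  has_deriv_on T f t a -> has_deriv_on T g t b ->
  has_deriv_on T (fun s => f s + g s) t (a + b).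
Proof.
move=> fa gb; rewrite /has_deriv_on.
under eq_fun do rewrite opprD addrACA scalerDr.
exact: cvg_addmx.
Qed.

Lemma has_deriv_on_opp (m n : nat) (f : K -> 'M[K]_(m, n)) (t : K)
    (a : 'M[K]_(m, n)) :
  has_deriv_on T f t a -> has_deriv_on T (fun s => - f s) t (- a).
Proof.
move=> fa; rewrite /has_deriv_on.
under eq_fun do rewrite -opprD scalerN.
exact: cvg_oppmx.
Qed.

Lemma has_deriv_on_tr (m n : nat) (f : K -> 'M[K]_(m, n)) (t : K)
    (a : 'M[K]_(m, n)) :
  has_deriv_on T f t a -> has_deriv_on T (fun s => (f s)^T) t a^T.
Proof.
move=> fa; rewrite /has_deriv_on.
under eq_fun do rewrite -linearB -linearZ.
exact: cvg_trmx.
Qed.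

Lemma has_deriv_on_mul (m n p : nat) (f : K -> 'M[K]_(m, n))
    (g : K -> 'M[K]_(n, p)) (t : K) (a : 'M[K]_(m, n)) (b : 'M[K]_(n, p)) :
  has_deriv_on T f t a -> has_deriv_on T g t b ->
  has_deriv_on T (fun s => f s *m g s) t (a *m g t + f t *m b).
Proof.
move=> fa gb; rewrite /has_deriv_on.
(* The increment of the product is [(f s - f t) g s + f t (g s - g t)], which keeps the order of the
   factors and leaves only the continuity of [g] at [t] to be used. *)
rewrite [X in X @ _ --> _](_ : _ = fun s => ((s - t)^-1 *: (f s - f t)) *m g s
    + f t *m ((s - t)^-1 *: (g s - g t))); last first.
  apply/funext => s; rewrite -scalemxAl -scalemxAr -scalerDr mulmxBl mulmxBr.
  by rewrite addrA subrK.
apply: cvg_addmx; apply: cvg_mulmx => //; last exact: cvg_cst.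
exact: has_deriv_on_cvg gb.
Qed.

(** This is the limit of the identity [X^-1 - Y^-1 = - X^-1 (X - Y) Y^-1] divided by [s - t]. The
    filter lives on [[0, T]], where [f] is invertible. *)
Lemma has_deriv_on_inv (n : nat) (f : K -> 'M[K]_n) (t : K) (a : 'M[K]_n) :
  0 <= t <= T -> (forall s, 0 <= s <= T -> f s \in unitmx) ->
  has_deriv_on T f t a ->
  has_deriv_on T (fun s => invmx (f s)) t (- (invmx (f t) *m a *m invmx (f t))).
Proof.
move=> tT fU fa; rewrite /has_deriv_on.
have e : \forall s \near within `[0, T] t^',
    - (invmx (f s) *m ((s - t)^-1 *: (f s - f t)) *m invmx (f t))
    = (s - t)^-1 *: (invmx (f s) - invmx (f t)).
  apply: (@filterS _ _ _ `[0, T]); last exact: withinT.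
  move=> s /=; rewrite in_itv /= => sT.
  rewrite -scalemxAr -scalemxAl -scalerN mulmxBr mulVmx ?fU// mulmxBl mul1mx.
  by rewrite -mulmxA mulmxV ?fU// mulmx1 opprB.
apply: cvg_trans (near_eq_cvg e) _.
apply: cvg_oppmx; apply: cvg_mulmx; last exact: cvg_cst.
apply: cvg_mulmx => //; apply: cvg_invmx; first exact: fU.
exact: has_deriv_on_cvg fa.
Qed.

(** A real function is read as a 1 by 1 matrix, so that the matrix rules and the uniqueness results
    also serve real functions. *)
Lemma has_deriv_on_scalar (f : K -> K) (t l : K) :
  has_deriv_on_real T f t l <->
  has_deriv_on T (fun s => (f s)%:M : 'M[K]_1) t (l%:M).
Proof.
split=> [fl|/has_deriv_on_mxP /(_ 0 0)].
  apply/has_deriv_on_mxP => i j; rewrite !ord1 mxE eqxx mulr1n.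
  by under eq_fun do rewrite mxE eqxx mulr1n.
by rewrite mxE eqxx mulr1n; under eq_fun do rewrite mxE eqxx mulr1n.
Qed.

End DerivativeRules.

(** * Real calculus on a closed interval *)

Section Calculus.
Variables (K : realType) (T : K).

(** [is_derive] takes limits in the increment at 0, [has_deriv_on] takes them in the point [s] at
    [t]; this change of variable links the two. *)
Lemma cvg_dnbhs_shift (f : K -> K) (t : K) : (f \o shift t) @ 0^' = f @ t^'.
Proof.
rewrite funeqE => A.
have e0 (h : K) : (h + t != t) = (h != 0) by rewrite -subr_eq0 addrK.
have e := near_shift 0 t (fun s => s != t -> A (f s)).
symmetry; etransitivity; first exact: e.
rewrite subr0.
have -> // : (fun s => s != t -> A (f s)) \o shift t
    = (fun h => h != 0 -> A (f (h + t))).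
apply/funext => h /=.
by rewrite (e0 h).
Qed.

Lemma within_dnbhs_interior (t : K) : 0 < t < T -> within `[0, T] t^' = t^'.
Proof.
move=> t0T; rewrite eqEsubset; split => U; last exact: cvg_within.
rewrite {1}/within /= => UU.
have tU : \forall s \near t^', s \in `[0, T].
  have : t \in `]0, T[ by rewrite in_itv.
  move=> /near_in_itvoo tU; apply: cvg_within; apply: filterS tU => s.
  by rewrite !in_itv /= => /andP[/ltW -> /ltW ->].
by apply: filterS2 tU UU => s sT; exact.
Unshelve. all: by end_near. Qed.

Lemma derive_quotient_shift (f : K -> K) (t : K) :
  (fun h => h^-1 *: (f (h *: 1 + t) - f t)) =
  (fun s => (s - t)^-1 * (f s - f t)) \o shift t.
Proof. by apply/funext => h /=; rewrite addrK [h *: 1]mulr1. Qed.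

Lemma is_derive_cvg (f : K -> K) (t l : K) :
  (fun s => (s - t)^-1 * (f s - f t)) @ t^' --> l <-> is_derive t 1 f l.
Proof.
split=> [fl|[]]; last first.
  by rewrite /derivable /derive -(cvg_dnbhs_shift _ t) -derive_quotient_shift => cf <-.
rewrite -(cvg_dnbhs_shift _ t) -derive_quotient_shift in fl; apply: DeriveDef.
  by apply/cvg_ex; exists l.
exact: cvg_lim.
Qed.

Lemma is_derive_has_deriv_on (f : K -> K) (t l : K) :
  is_derive t 1 f l -> has_deriv_on_real T f t l.
Proof. by move=> /is_derive_cvg fl; exact: cvg_within_filter. Qed.

Lemma has_deriv_on_is_derive (f : K -> K) (t l : K) : 0 < t < T ->
  has_deriv_on_real T f t l -> is_derive t 1 f l.
Proof.
by move=> tT; rewrite /has_deriv_on_real within_dnbhs_interior// => /is_derive_cvg.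
Qed.

(** The filter is that of [has_deriv_on], so the limit rules above apply directly; [cont_onP] shows
    that puncturing it does not change the notion. *)
Definition cont_on (U : topologicalType) (f : K -> U) :=
  forall t, 0 <= t <= T -> f @ within `[0, T] t^' --> f t.

Lemma cont_onP (U : topologicalType) (f : K -> U) :
  cont_on f <-> {within `[0, T], continuous f}.
Proof.
split=> [fc|/subspace_continuousP fc t tT].
  apply/subspace_continuousP => t; rewrite /= in_itv /= => tT A fA.
  have H : \forall s \near t, s != t -> s \in `[0, T] -> A (f s) := fc t tT A fA.
  suff : \forall s \near t, s \in `[0, T] -> A (f s) by [].
  apply: filterS H => s sA s0T; have [->|st] := eqVneq s t.
    exact: (nbhs_singleton fA).
  exact: sA.
have := fc t; rewrite /= in_itv /= => /(_ tT) h A fA.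
have H : \forall s \near t, s \in `[0, T] -> A (f s) := h A fA.
suff : \forall s \near t, s != t -> s \in `[0, T] -> A (f s) by [].
by apply: filterS H => s sA _.
Qed.

Lemma has_deriv_on_cont_on (m n : nat) (f f' : K -> 'M[K]_(m, n)) :
  (forall t, 0 <= t <= T -> has_deriv_on T f t (f' t)) -> cont_on f.
Proof. by move=> fl t /fl; exact: has_deriv_on_cvg. Qed.

Lemma cont_on_bounded (f : K -> K) : 0 <= T -> cont_on f ->
  exists2 M, 0 <= M & forall t, 0 <= t <= T -> `|f t| <= M.
Proof.
move=> T0 /cont_onP fc.
have nc : {within `[0, T], continuous (fun t => `|f t|)}.
  by move=> t; apply: cvg_norm; exact: fc.
have [c _ cmax] := EVT_max T0 nc.
by exists `|f c| => // t tT; apply: cmax; rewrite in_itv.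
Qed.

(** Inside []a, b[] the relative derivative is an ordinary one; at the endpoints it supplies the
    continuity that the monotonicity criterion asks for. *)
Lemma has_deriv_on_ge0_le (f f' : K -> K) (a b : K) :
  0 <= a -> a <= b -> b <= T ->
  (forall t, a <= t <= b -> has_deriv_on_real T f t (f' t)) ->
  (forall t, a < t < b -> 0 <= f' t) -> f a <= f b.
Proof.
move=> a0 ab bT fl f'0.
have fd t : t \in `]a, b[ -> is_derive t 1 f (f' t).
  rewrite in_itv /= => /andP[at_ tb].
  apply: has_deriv_on_is_derive; last by apply: fl; rewrite !ltW.
  by rewrite (le_lt_trans a0 at_) (lt_le_trans tb bT).
apply: (@ger0_derive1_le_cc K f a b); rewrite ?in_itv /= ?lexx ?ab//.
- by move=> t /fd [].
- move=> t tab; rewrite derive1E; have [_ ->] := fd _ tab.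
  exact: f'0.
apply/subspace_continuousP => t; rewrite /= in_itv /= => tab A fA.
have /has_deriv_on_scalar/has_deriv_on_cvg/cvg_mxP/(_ 0 0) := fl t tab.
rewrite mxE eqxx mulr1n; under eq_fun do rewrite mxE eqxx mulr1n.
move=> /(_ A fA) H.
have {}H : \forall s \near t, s != t -> s \in `[0, T] -> A (f s) := H.
suff : \forall s \near t, s \in `[a, b] -> A (f s) by [].
apply: filterS H => s sA; rewrite in_itv /= => /andP[as_ sb].
have [->|/sA] := eqVneq s t; first exact: (nbhs_singleton fA).
by apply; rewrite in_itv /= (le_trans a0 as_) (le_trans sb bT).
Qed.

Lemma cont_on_primitive (f : K -> K) (c : K) : 0 < T -> cont_on f ->
  exists2 F : K -> K, F T = c &
    forall t, 0 <= t <= T -> has_deriv_on_real T F t (f t).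
Proof.
move=> T0 /cont_onP fc.
(* Clamping the argument to [[0, T]] extends [f] to a function continuous on the whole line. *)
pose cl (t : K) := Num.max 0 (Num.min T t).
have clT t : 0 <= cl t <= T.
  rewrite /cl le_max lexx /= ge_max (ltW T0) /= ge_min lexx//.
have clid t : 0 <= t <= T -> cl t = t.
  by rewrite /cl => /andP[t0 tT]; rewrite min_r// max_r.
have clc : continuous cl.
  move=> t; apply: continuous_max; first exact: cst_continuous.
  by apply: continuous_min; first exact: cst_continuous.
pose g := f \o cl.
have gc : continuous g.
  move=> t; move/subspace_continuousP: fc => /(_ (cl t)).
  rewrite /= in_itv /= => /(_ (clT t)) fc A fA.
  have fA' : \forall s \near cl t, s \in `[0, T] -> A (f s) := fc A fA.
  have H : \forall s \near t, cl s \in `[0, T] -> A (f (cl s)) := clc t _ fA'.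
  suff : \forall s \near t, A (f (cl s)) by [].
  by apply: filterS H => s; apply; rewrite in_itv /=.
(* The integral runs over [[-1, T + 1]] so that the endpoints 0 and [T] are interior points, where
   the fundamental theorem gives a two-sided derivative. *)
pose F x := (\int[lebesgue_measure]_(t in `[-1, x]) g t)%R.
exists (fun t => F t - F T + c) => [|t tT]; first by rewrite subrr add0r.
have gi : lebesgue_measure.-integrable `[-1, T + 1] (EFin \o g).
  apply: continuous_compact_integrable; first exact: segment_compact.
  exact: continuous_subspaceT.
have [||Fd Fe] := @continuous_FTC1_closed K g (-1) t (T + 1) _ gi _ (gc t).
- by case/andP: tT => _ /le_lt_trans; apply; rewrite ltrDl.
- by case/andP: tT => t0 _; apply: lt_le_trans t0; rewrite ltrN10.
apply: is_derive_has_deriv_on.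
have Fd' : is_derive t 1 F (f t).
  by apply: DeriveDef => //; rewrite -derive1E Fe /g /= clid.
by apply: is_derive_eq; rewrite subr0 addr0.
Qed.

End Calculus.

(** * Matrix exponential and linear systems with constant coefficients *)

Section ConstantCoefficients.
Variables (K : realType) (n : nat) (N : 'M[K]_n).

(** These are the Taylor coefficients of an entry of [M exp(t N)]. With the extra left factor [M]
    the family is closed under differentiation, which replaces [M] by [M N]. *)
Definition expmx_coeff (M : 'M[K]_n) (i j : 'I_n) (k : nat) : K :=
  (M *m N ^+ k) i j / k`!%:R.

Definition expmx (M : 'M[K]_n) (t : K) : 'M[K]_n :=
  \matrix_(i, j) limn (pseries (expmx_coeff M i j) t).

(** With [C] the sum of the absolute values of the entries of [N], each further factor [N]
    multiplies an entrywise bound by at most [C]. The geometric growth lets the exponential series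
    of [C |t|] dominate. *)
Lemma mulmx_exp_le (M : 'M[K]_n) : exists C : K, 0 <= C /\ exists2 D : K, 0 <= D &
  forall i j k, `|(M *m N ^+ k) i j| <= D * C ^+ k.
Proof.
pose C : K := \sum_i \sum_j `|N i j|.
have C0 : 0 <= C by apply: sumr_ge0 => i _; exact: sumr_ge0.
exists C; split => //; exists (\sum_i \sum_j `|M i j|).
  by apply: sumr_ge0 => i _; exact: sumr_ge0.
move=> i j k; elim: k i j => [|k IH] i j.
  rewrite expr0 mulmx1 mulr1 (bigD1 i)//= (bigD1 j)//= -addrA lerDl.
  by apply: addr_ge0; apply: sumr_ge0 => // l _; exact: sumr_ge0.
rewrite exprSr [in leRHS]exprSr -mulmxE mulmxA mxE mulrA.
apply: (le_trans (ler_norm_sum _ _ _)); rewrite [in leRHS]/C mulr_sumr.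
apply: ler_sum => l _; rewrite normrM; apply: ler_pM => //.
rewrite (bigD1 j)//= lerDl; exact: sumr_ge0.
Qed.

Lemma is_cvg_expmx (M : 'M[K]_n) (i j : 'I_n) (t : K) :
  cvgn (pseries (expmx_coeff M i j) t).
Proof.
have [C [C0 [D D0 le]]] := mulmx_exp_le M.
apply: normed_cvg.
apply: (@series_le_cvg _ _ (fun k => D * exp_coeff (C * `|t|) k)).
- by move=> k; exact: normr_ge0.
- move=> k; apply: mulr_ge0 => //; apply: exp_coeff_ge0; exact: mulr_ge0.
- move=> k; rewrite /= /expmx_coeff /exp_coeff /= exprMn !normrM normrX normfV normr_nat.
  rewrite -!mulrA [k`!%:R^-1 * _]mulrC !mulrA ler_wpM2r ?invr_ge0//.
  by rewrite ler_wpM2r ?exprn_ge0.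
- rewrite seriesZ; apply: is_cvgMr; exact: is_cvg_series_exp_coeff.
Qed.

Lemma is_derive_expmx (M : 'M[K]_n) (i j : 'I_n) (t : K) :
  is_derive t 1 (fun s => expmx M s i j) (expmx (M *m N) t i j).
Proof.
have diffs M' : pseries_diffs (expmx_coeff M' i j) = expmx_coeff (M' *m N) i j.
  apply/funext => k; rewrite /pseries_diffs /expmx_coeff factS natrM invfM.
  by rewrite exprS -mulmxE mulmxA mulrCA mulVKf.
rewrite mxE; under eq_fun do rewrite mxE; rewrite -diffs.
(* Termwise differentiation needs convergence of the series and of its derived series at some point
   of modulus larger than [|t|]; [|t| + 1] is one. *)
apply: (@pseries_snd_diffs _ _ (`|t| + 1)); rewrite ?diffs; try exact: is_cvg_expmx.
by rewrite [ltRHS]ger0_norm ?addr_ge0// ltrDl.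
Qed.

Lemma expmxM (t : K) : expmx N t = N *m expmx 1%:M t.
Proof.
apply/matrixP => i j; rewrite !mxE; apply: cvg_lim => //.
under eq_bigr do rewrite mxE.
rewrite (_ : pseries _ _ =
    fun m => \sum_l N i l * pseries (expmx_coeff 1%:M l j) t m).
  by apply: cvg_sumr => l; apply: cvgMr; exact: is_cvg_expmx.
apply/funext => m; rewrite /pseries /series /=.
under [RHS]eq_bigr do rewrite mulr_sumr.
rewrite exchange_big /=; apply: eq_bigr => k _.
rewrite /expmx_coeff mxE !mulr_suml; apply: eq_bigr => l _.
by rewrite mul1mx !mulrA.
Qed.

Lemma expmx0 : expmx 1%:M 0 = 1%:M.
Proof.
apply/matrixP => i j; rewrite !mxE; apply: cvg_lim => //.
(* The empty partial sum is 0; from the first index on, the partial sums at 0 all equal the constant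
   term. *)
rewrite -cvg_shiftS /=.
rewrite (_ : (fun k => pseries _ _ k.+1) = fun=> (i == j)%:R); first exact: cvg_cst.
apply/funext => k; rewrite /pseries /series /= big_nat_recl// big1.
  by rewrite /expmx_coeff mul1mx !expr0 mxE fact0 divr1 mulr1 addr0.
by move=> l _; rewrite expr0n mulr0.
Qed.

Lemma linear_cst_system (T : K) (m : nat) (x0 : 'M[K]_(n, m)) :
  exists2 Z : K -> 'M[K]_(n, m), Z T = x0 &
    forall t, has_deriv_on T Z t (N *m Z t).
Proof.
(* The solution is [exp((t - T) N) x0], with time counted from the terminal time. *)
exists (fun t => expmx 1%:M (t - T) *m x0) => [|t].
  by rewrite subrr expmx0 mul1mx.
have Ed : has_deriv_on T (fun s => expmx 1%:M (s - T)) t (expmx N (t - T)).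
  apply/has_deriv_on_mxP => i j; apply: is_derive_has_deriv_on.
  have := @is_derive1_comp _ (fun s => expmx 1%:M s i j) (fun s => s - T) t
    (expmx (1%:M *m N) (t - T) i j) 1.
  rewrite mul1mx mulr1; apply.
    by have := is_derive_expmx 1%:M i j (t - T); rewrite mul1mx.
  by apply: is_derive_eq; rewrite subr0.
have := has_deriv_on_mul Ed (has_deriv_on_cst T x0 t).
by rewrite mulmx0 addr0 expmxM mulmxA.
Qed.

End ConstantCoefficients.

(** * Gronwall's inequality and uniqueness for linear equations *)

Section Gronwall.
Variables (K : realType) (T : K).

Lemma has_deriv_on_realM (f g : K -> K) (t a b : K) :
  has_deriv_on_real T f t a -> has_deriv_on_real T g t b ->
  has_deriv_on_real T (fun s => f s * g s) t (a * g t + f t * b).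
Proof.
move=> /has_deriv_on_scalar fa /has_deriv_on_scalar gb.
apply/has_deriv_on_scalar; rewrite raddfD /= !scalar_mxM.
under eq_fun do rewrite scalar_mxM.
exact: (has_deriv_on_mul fa gb).
Qed.

Lemma has_deriv_on_realN (f : K -> K) (t a : K) :
  has_deriv_on_real T f t a -> has_deriv_on_real T (fun s => - f s) t (- a).
Proof.
move=> fa; rewrite /has_deriv_on_real; under eq_fun do rewrite -opprD mulrN.
exact: cvgN.
Qed.

Lemma has_deriv_on_real_sum (I : finType) (f : I -> K -> K) (a : I -> K) (t : K) :
  (forall i, has_deriv_on_real T (f i) t (a i)) ->
  has_deriv_on_real T (fun s => \sum_i f i s) t (\sum_i a i).
Proof.
move=> fa; rewrite /has_deriv_on_real.
under eq_fun do rewrite -sumrB mulr_sumr.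
exact: cvg_sumr.
Qed.

(** To the right of [c] the function [exp(- k t) g t] is nonincreasing, to the left [exp(k t) g t]
    is nondecreasing. Both vanish at [c], so [g <= 0] on either side. *)
Lemma gronwall_eq0 (g g' : K -> K) (k a b c : K) :
  0 <= a -> b <= T -> a <= c <= b -> g c = 0 ->
  (forall t, a <= t <= b -> 0 <= g t) ->
  (forall t, a <= t <= b -> has_deriv_on_real T g t (g' t)) ->
  (forall t, a < t < b -> `|g' t| <= k * g t) ->
  forall t, a <= t <= b -> g t = 0.
Proof.
move=> a0 bT /andP[ac cb] gc g0 gd gb t /andP[at_ tb].
have ed (l s : K) : has_deriv_on_real T (fun u => expR (l * u)) s (l * expR (l * s)).
  apply: is_derive_has_deriv_on; rewrite mulrC -[X in _ * X]mulr1.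
  apply: (@is_derive1_comp _ expR (fun u => l * u)).
apply/eqP; rewrite eq_le g0 ?at_ ?tb// andbT.
have [ct|/ltW tc] := leP c t.
- have := @has_deriv_on_ge0_le _ T (fun u => - (expR (- k * u) * g u))
    (fun u => - (- k * expR (- k * u) * g u + expR (- k * u) * g' u)) c t
    (le_trans a0 ac) ct (le_trans tb bT).
  rewrite gc mulr0 oppr0 oppr_ge0 pmulr_rle0 ?expR_gt0//; apply.
    move=> s /andP[cs st]; apply: has_deriv_on_realN.
    by apply: has_deriv_on_realM => //; apply: gd; rewrite (le_trans ac cs) (le_trans st tb).
  move=> s /andP[cs st].
  have -> : - k * expR (- k * s) * g s + expR (- k * s) * g' s
      = expR (- k * s) * (g' s - k * g s).
    by ring.
  rewrite oppr_ge0 pmulr_rle0 ?expR_gt0// subr_le0.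
  apply: le_trans (ler_norm _) (gb _ _).
  by rewrite (le_lt_trans ac cs) (lt_le_trans st tb).
- have := @has_deriv_on_ge0_le _ T (fun u => expR (k * u) * g u)
    (fun u => k * expR (k * u) * g u + expR (k * u) * g' u) t c
    (le_trans a0 at_) tc (le_trans cb bT).
  rewrite gc mulr0 pmulr_rle0 ?expR_gt0//; apply.
    move=> s /andP[ts sc].
    by apply: has_deriv_on_realM => //; apply: gd; rewrite (le_trans at_ ts) (le_trans sc cb).
  move=> s /andP[ts sc].
  have -> : k * expR (k * s) * g s + expR (k * s) * g' s
      = expR (k * s) * (g' s + k * g s).
    by ring.
  rewrite mulr_ge0 ?expR_ge0// -lerBlDr sub0r.
  rewrite lerNl; apply: le_trans (gb s _); first by rewrite -normrN ler_norm.
  by rewrite (le_lt_trans at_ ts) (lt_le_trans sc cb).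
Qed.

Lemma cont_on_bounded_mx (m n : nat) (L : K -> 'M[K]_(m, n)) : 0 <= T ->
  cont_on T L ->
  exists2 C, 0 <= C & forall t, 0 <= t <= T -> \sum_i \sum_j `|L t i j| <= C.
Proof.
move=> T0 Lc.
have [|C C0 le] := @cont_on_bounded K T (fun t => \sum_i \sum_j `|L t i j|) T0.
  move=> t /Lc /cvg_mxP Lt; apply: cvg_sumr => i; apply: cvg_sumr => j.
  by apply: cvg_norm; exact: Lt.
by exists C => // t tT; exact: le_trans (ler_norm _) (le t tT).
Qed.

(** Gronwall is applied to the squared Frobenius norm [g] of [f], with coefficients bounded by
    compactness. The equation is assumed only inside []a, b[], the form in which the Hamiltonian
    argument provides it. *)
Lemma linear_eq0 (m n : nat) (L : K -> 'M[K]_m) (N : K -> 'M[K]_n)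
    (f d : K -> 'M[K]_(m, n)) (a b c : K) :
  cont_on T L -> cont_on T N ->
  0 <= a -> b <= T -> a <= c <= b -> f c = 0 ->
  (forall t, a <= t <= b -> has_deriv_on T f t (d t)) ->
  (forall t, a < t < b -> d t = L t *m f t + f t *m N t) ->
  forall t, a <= t <= b -> f t = 0.
Proof.
move=> Lc Nc a0 bT acb fc fd dE.
have T0 : 0 <= T.
  by case/andP: acb => ac cb; exact: le_trans a0 (le_trans ac (le_trans cb bT)).
have [CL CL0 Lle] := cont_on_bounded_mx T0 Lc.
have [CN CN0 Nle] := cont_on_bounded_mx T0 Nc.
pose g t := \sum_i \sum_j f t i j * f t i j.
have g0 t : 0 <= g t.
  by apply: sumr_ge0 => i _; apply: sumr_ge0 => j _; exact: sqr_ge0.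
have fle t i j : `|f t i j| <= Num.sqrt (g t).
  rewrite -sqrtr_sqr ler_wsqrtr// expr2 /g (bigD1 i)//= (bigD1 j)//= -addrA lerDl.
  by apply: addr_ge0; apply: sumr_ge0 => *; [|apply: sumr_ge0 => *]; exact: sqr_ge0.
have dle t i j : a < t < b -> `|d t i j| <= (CL + CN) * Num.sqrt (g t).
  move=> tab; have /andP[/ltW at_ /ltW tb] := tab.
  have tT : 0 <= t <= T by rewrite (le_trans a0 at_) (le_trans tb bT).
  rewrite dE// mxE mulrDl; apply: le_trans (ler_normD _ _) _; apply: lerD.
    rewrite mxE; apply: le_trans (ler_norm_sum _ _ _) _.
    apply: (@le_trans _ _ (\sum_k `|L t i k| * Num.sqrt (g t))).
      by apply: ler_sum => k _; rewrite normrM ler_wpM2l.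
    rewrite -mulr_suml ler_wpM2r ?sqrtr_ge0//; apply: le_trans (Lle t tT).
    by rewrite [leRHS](bigD1 i)//= lerDl; apply: sumr_ge0 => l _; exact: sumr_ge0.
  rewrite mxE; apply: le_trans (ler_norm_sum _ _ _) _.
  apply: (@le_trans _ _ (\sum_k `|N t k j| * Num.sqrt (g t))).
    by apply: ler_sum => k _; rewrite normrM mulrC ler_wpM2l.
  rewrite -mulr_suml ler_wpM2r ?sqrtr_ge0//; apply: le_trans (Nle t tT).
  apply: ler_sum => k _.
  by rewrite [leRHS](bigD1 j)//= lerDl; exact: sumr_ge0.
have gz : forall t, a <= t <= b -> g t = 0.
  (* Each of the [m n] entries contributes [2 d f] to the derivative of [g], and
     [|d| <= (CL + CN) sqrt g], [|f| <= sqrt g]. *)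
  pose C := (m * n)%:R * (2 * (CL + CN)).
  apply: (@gronwall_eq0 g (fun t => \sum_i \sum_j (d t i j * f t i j + f t i j * d t i j))
    C a b c) => //.
  - by rewrite /g fc; apply: big1 => i _; apply: big1 => j _; rewrite mxE mul0r.
  - move=> t tab; apply: has_deriv_on_real_sum => i.
    apply: has_deriv_on_real_sum => j.
    by have /has_deriv_on_mxP/(_ i j) fij := fd t tab; exact: has_deriv_on_realM.
  move=> t tab; apply: le_trans (ler_norm_sum _ _ _) _.
  apply: (@le_trans _ _ (\sum_(i < m) \sum_(j < n) 2 * (CL + CN) * g t)); last first.
    by rewrite !sumr_const !card_ord -mulrnA /C mulnC -[leLHS]mulr_natl !mulrA.
  apply: ler_sum => i _; apply: le_trans (ler_norm_sum _ _ _) _.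
  apply: ler_sum => j _; rewrite [f t i j * _]mulrC.
  have h : `|d t i j * f t i j| <= (CL + CN) * g t.
    have -> : g t = Num.sqrt (g t) * Num.sqrt (g t) by rewrite -expr2 sqr_sqrtr.
    by rewrite normrM mulrA ler_pM// dle.
  apply: le_trans (ler_normD _ _) _; rewrite -mulrA; lra.
move=> t /gz /eqP; rewrite psumr_eq0 => [/allP h|i _]; last first.
  by apply: sumr_ge0 => j _; exact: sqr_ge0.
apply/matrixP => i j; rewrite mxE; have /h /= := mem_index_enum i.
rewrite psumr_eq0 => [/allP/(_ j (mem_index_enum j))|k _]; last exact: sqr_ge0.
by rewrite /= mulf_eq0 orbb => /eqP.
Qed.

End Gronwall.

(** * Entrywise proofs of matrix identities *)

Section EntryRules.
Variables (K : realType) (m n : nat).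

Lemma addmxE (A B : 'M[K]_(m, n)) i j : (A + B) i j = A i j + B i j.
Proof. by rewrite mxE. Qed.

Lemma oppmxE (A : 'M[K]_(m, n)) i j : (- A) i j = - A i j.
Proof. by rewrite mxE. Qed.

Lemma scalemxE (a : K) (A : 'M[K]_(m, n)) i j : (a *: A) i j = a * A i j.
Proof. by rewrite mxE. Qed.

Lemma trmxD (A B : 'M[K]_(m, n)) : (A + B)^T = A^T + B^T.
Proof. exact: linearD. Qed.

Lemma trmxN (A : 'M[K]_(m, n)) : (- A)^T = - A^T.
Proof. exact: linearN. Qed.

End EntryRules.

(* Once products are expanded and left-associated, an identity between
   noncommutative matrix polynomials only involves sums of monomials, and [ring]
   can decide it entrywise with the monomials as atoms. *)
Ltac mx_ring :=
  apply/matrixP => ? ?;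
  rewrite ?(mulmxDl, mulmxDr, mulNmx, mulmxN, mulmxA, opprD, opprK,
            mul1mx, mulmx1, mul0mx, mulmx0);
  rewrite ?(addmxE, oppmxE, scalemxE); ring.

(** * Positive semidefinite matrices *)

Section PositiveSemidefinite.
Variable K : realType.

Lemma symmetricmxP (n : nat) (M : 'M[K]_n) : M \is symmetricmx <-> M^T = M.
Proof.
rewrite is_hermitianmxE expr0 scale1r map_mx_id//.
by split=> [/eqP <-|->].
Qed.

Lemma bilin_congr (m n : nat) (Q : 'M[K]_m) (C : 'M[K]_(m, n)) (x : 'cV[K]_n) :
  bilin x (C^T *m Q *m C) x = bilin (C *m x) Q (C *m x).
Proof. by rewrite /bilin trmx_mul !mulmxA. Qed.

Lemma sym_psd_congr (m n : nat) (Q : 'M[K]_m) (C : 'M[K]_(m, n)) :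
  sym_psd Q -> sym_psd (C^T *m Q *m C).
Proof.
move=> [/symmetricmxP Qs Q0]; split; last by move=> x; rewrite bilin_congr.
by apply/symmetricmxP; rewrite !trmx_mul trmxK Qs mulmxA.
Qed.

Lemma sym_pd_psd (n : nat) (R : 'M[K]_n) : sym_pd R -> sym_psd R.
Proof.
move=> [Rs R0]; split => // x; have [->|/R0/ltW//] := eqVneq x 0.
by rewrite /bilin mulmx0 mxE.
Qed.

Lemma sym_pd_unit (n : nat) (R : 'M[K]_n) : sym_pd R -> R \in unitmx.
Proof.
move=> [_ R0]; rewrite unitmxE unitfE; apply/det0P => -[v v0 vR].
have : 0 < bilin v^T R v^T by apply: R0; rewrite trmx_eq0.
by rewrite /bilin trmxK vR mul0mx mxE ltxx.
Qed.

Lemma BRB_psd (n n1 : nat) (B : 'M[K]_(n, n1)) (R : 'M[K]_n1) :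
  sym_pd R -> sym_psd (BRB B R).
Proof.
move=> R0; have RU := sym_pd_unit R0; have /symmetricmxP Rs := R0.1.
(* Written as a congruence of [R] itself, the matrix is semidefinite without a separate study of the
   inverse of [R]. *)
have -> : BRB B R = (invmx R *m B^T)^T *m R *m (invmx R *m B^T).
  by rewrite trmx_mul trmxK trmx_inv Rs mulmxA -(mulmxA _ _ R) mulVmx// mulmx1.
exact/sym_psd_congr/sym_pd_psd.
Qed.

Lemma dot_ge0 (n : nat) (x : 'cV[K]_n) : 0 <= (x^T *m x) 0 0.
Proof. by rewrite mxE; apply: sumr_ge0 => i _; rewrite mxE -expr2 sqr_ge0. Qed.

Lemma dot_eq0 (n : nat) (x : 'cV[K]_n) : (x^T *m x) 0 0 = 0 -> x = 0.
Proof.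
rewrite mxE => /eqP; rewrite psumr_eq0 => [/allP x0|i _]; last by rewrite mxE -expr2 sqr_ge0.
apply/colP => i; rewrite mxE.
by have := x0 i (mem_index_enum i); rewrite /= mxE mulf_eq0 orbb => /eqP.
Qed.

(** Moving from [y] in the direction [- M y] changes the form to first order by [- 2 e |M y|^2];
    since the form is 0 at [y] and nonnegative everywhere, [M y] must vanish. *)
Lemma sym_psd_ker (n : nat) (M : 'M[K]_n) (y : 'cV[K]_n) :
  sym_psd M -> bilin y M y = 0 -> M *m y = 0.
Proof.
move=> [/symmetricmxP Ms M0] yMy; apply: dot_eq0.
set p := _ 0 0; have p0 : 0 <= p by exact: dot_ge0.
pose z := M *m y; pose c := bilin z M z.
have c0 : 0 <= c by exact: M0.
have quad e : bilin (y - e *: z) M (y - e *: z) = - 2 * e * p + e ^+ 2 * c.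
  have -> : bilin (y - e *: z) M (y - e *: z)
      = bilin y M y - e * (y^T *m M *m z) 0 0 - e * (z^T *m M *m y) 0 0 + e ^+ 2 * c.
    have tE : (y - e *: z)^T = y^T - e *: z^T by rewrite linearB linearZ.
    rewrite /bilin tE !(mulmxBl, mulmxBr) -!(scalemxAl, scalemxAr).
    by rewrite !(addmxE, oppmxE, scalemxE) /c /bilin; ring.
  rewrite yMy (_ : y^T *m M = z^T); last by rewrite trmx_mul Ms.
  by rewrite -mulmxA -/z -/p; ring.
apply/eqP; apply: contraT => pn0.
have pp : 0 < p by rewrite lt_neqAle eq_sym pn0.
(* This step size turns the quadratic into [- e (p + e)], which is negative; adding 1 keeps the
   denominator positive when [c = 0]. *)
pose e := p / (c + 1); have c1 : 0 < c + 1 by rewrite ltr_wpDl.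
have e0 : 0 < e by rewrite divr_gt0.
have : 0 <= - 2 * e * p + e ^+ 2 * c by rewrite -quad; exact: M0.
have ec : e * (c + 1) = p by rewrite /e divfK// gt_eqF.
rewrite leNgt => /negP; case.
have -> : - 2 * e * p + e ^+ 2 * c = - (e * (p + e)) by rewrite -ec; ring.
by rewrite oppr_lt0 mulr_gt0// addr_gt0.
Qed.

End PositiveSemidefinite.

(** * Sylvester and Riccati equations with terminal data *)

Section MatrixEquations.
Variables (K : realType) (T : K).
Hypothesis T0 : 0 < T.

(** The difference [f - g] solves a homogeneous linear equation. [L] and [N] may be built from [f]
    and [g] themselves, which covers nonlinear equations as well. *)
Lemma has_deriv_on_uniq (m n : nat) (f g : K -> 'M[K]_(m, n)) (d e : K -> 'M[K]_(m, n))
    (L : K -> 'M[K]_m) (N : K -> 'M[K]_n) :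
  cont_on T L -> cont_on T N -> f T = g T ->
  (forall t, 0 <= t <= T -> has_deriv_on T f t (d t)) ->
  (forall t, 0 <= t <= T -> has_deriv_on T g t (e t)) ->
  (forall t, 0 <= t <= T -> d t - e t = L t *m (f t - g t) + (f t - g t) *m N t) ->
  forall t, 0 <= t <= T -> f t = g t.
Proof.
move=> Lc Nc fgT fd ge deE t tT; apply/eqP; rewrite -subr_eq0; apply/eqP; move: t tT.
apply: (@linear_eq0 _ T _ _ L N (fun t => f t - g t) (fun t => d t - e t) 0 T T) => //.
- by rewrite (ltW T0) lexx.
- by rewrite fgT subrr.
- by move=> t tT; apply: has_deriv_on_add; [exact: fd|apply: has_deriv_on_opp; exact: ge].
- by move=> t /andP[t0 tT]; apply: deE; rewrite !ltW.
Qed.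

Lemma cont_on_primitive_mx (m n : nat) (F : K -> 'M[K]_(m, n)) (Z0 : 'M[K]_(m, n)) :
  cont_on T F -> exists2 Z : K -> 'M[K]_(m, n), Z T = Z0 &
    forall t, 0 <= t <= T -> has_deriv_on T Z t (F t).
Proof.
move=> Fc.
have /choice[Z ZP] : forall ij : 'I_m * 'I_n, exists z : K -> K, z T = Z0 ij.1 ij.2 /\
    forall t, 0 <= t <= T -> has_deriv_on_real T z t (F t ij.1 ij.2).
  move=> [i j]; have [|z zT zd] := @cont_on_primitive K T (fun t => F t i j) (Z0 i j) T0.
    by move=> t /Fc /cvg_mxP; exact.
  by exists z.
exists (fun t => \matrix_(i, j) Z (i, j) t) => [|t tT].
  by apply/matrixP => i j; rewrite mxE (ZP (i, j)).1.
apply/has_deriv_on_mxP => i j; under eq_fun do rewrite mxE.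
exact: (ZP (i, j)).2.
Qed.

(* Conjugating by the fundamental matrices [X1] and [X2] turns the Sylvester
   equation into [Z' = X1^T F X2]. *)
Lemma sylvester_exists (m n : nat) (A1 X1 : K -> 'M[K]_m) (A2 X2 : K -> 'M[K]_n)
    (F : K -> 'M[K]_(m, n)) (H0 : 'M[K]_(m, n)) :
  (forall t, 0 <= t <= T -> X1 t \in unitmx) ->
  (forall t, 0 <= t <= T -> X2 t \in unitmx) ->
  (forall t, 0 <= t <= T -> has_deriv_on T X1 t (A1 t *m X1 t)) ->
  (forall t, 0 <= t <= T -> has_deriv_on T X2 t (A2 t *m X2 t)) ->
  cont_on T F ->
  exists2 H : K -> 'M[K]_(m, n), H T = H0 &
    forall t, 0 <= t <= T ->
      has_deriv_on T H t (- ((A1 t)^T *m H t) - H t *m A2 t + F t).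
Proof.
move=> X1U X2U X1d X2d Fc.
have [|Z ZT Zd] := @cont_on_primitive_mx m n (fun t => (X1 t)^T *m F t *m X2 t)
    ((X1 T)^T *m H0 *m X2 T).
  move=> t tT; apply: cvg_mulmx; last exact: has_deriv_on_cvg (X2d t tT).
  by apply: cvg_mulmx (Fc t tT); apply: cvg_trmx; exact: has_deriv_on_cvg (X1d t tT).
have TT : 0 <= T <= T by rewrite (ltW T0) lexx.
have invd k (A X : K -> 'M[K]_k) t : 0 <= t <= T ->
    (forall t, 0 <= t <= T -> X t \in unitmx) ->
    has_deriv_on T X t (A t *m X t) ->
    has_deriv_on T (fun s => invmx (X s)) t (- (invmx (X t) *m A t)).
  move=> tT XU /(has_deriv_on_inv tT XU).
  by rewrite -!mulmxA mulmxV ?XU// mulmx1.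
exists (fun t => (invmx (X1 t))^T *m Z t *m invmx (X2 t)) => [|t tT].
  rewrite ZT trmx_inv !mulmxA mulVmx ?unitmx_tr ?X1U// mul1mx.
  by rewrite -mulmxA mulmxV ?X2U// mulmx1.
have d1 := has_deriv_on_tr (invd _ _ _ t tT X1U (X1d t tT)).
have d2 := invd _ _ _ t tT X2U (X2d t tT).
have := has_deriv_on_mul (has_deriv_on_mul d1 (Zd t tT)) d2.
rewrite trmxN trmx_mul; congr has_deriv_on.
have -> : (invmx (X1 t))^T *m ((X1 t)^T *m F t *m X2 t) = F t *m X2 t.
  by rewrite trmx_inv !mulmxA mulVmx ?unitmx_tr ?X1U// mul1mx.
rewrite mulmxDl -[F t *m _ *m _]mulmxA mulmxV ?X2U// mulmx1.
by mx_ring.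
Qed.

Lemma sylvester_unique (m n : nat) (A1 : K -> 'M[K]_m) (A2 : K -> 'M[K]_n)
    (F H1 H2 : K -> 'M[K]_(m, n)) :
  cont_on T A1 -> cont_on T A2 -> H1 T = H2 T ->
  (forall t, 0 <= t <= T ->
    has_deriv_on T H1 t (- ((A1 t)^T *m H1 t) - H1 t *m A2 t + F t)) ->
  (forall t, 0 <= t <= T ->
    has_deriv_on T H2 t (- ((A1 t)^T *m H2 t) - H2 t *m A2 t + F t)) ->
  forall t, 0 <= t <= T -> H1 t = H2 t.
Proof.
move=> A1c A2c H12 d1 d2.
apply: (@has_deriv_on_uniq _ _ _ _ _ _ (fun t => - (A1 t)^T) (fun t => - A2 t) _ _ H12 d1 d2).
- by move=> t tT; apply: cvg_oppmx; apply: cvg_trmx; exact: A1c.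
- by move=> t tT; apply: cvg_oppmx; exact: A2c.
- by move=> t tT; mx_ring.
Qed.

Definition riccati_sol (n : nat) (A M Q : 'M[K]_n) (P : K -> 'M[K]_n) :=
  forall t, 0 <= t <= T -> has_deriv_on T P t
    (- (A^T *m P t) - P t *m A + P t *m M *m P t - Q).

(** The quadratic terms differ by [P1 M (P1 - P2) + (P1 - P2) M P2], so the difference solves a
    linear equation with continuous coefficients. *)
Lemma riccati_unique (n : nat) (A M Q : 'M[K]_n) (P1 P2 : K -> 'M[K]_n) :
  riccati_sol A M Q P1 -> riccati_sol A M Q P2 -> P1 T = P2 T ->
  forall t, 0 <= t <= T -> P1 t = P2 t.
Proof.
move=> d1 d2 P12.
apply: (@has_deriv_on_uniq _ _ _ _ _ _ (fun t => - A^T + P1 t *m M)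
  (fun t => - A + M *m P2 t) _ _ P12 d1 d2).
- move=> t tT; apply: cvg_addmx; first exact: cvg_cst.
  by apply: cvg_mulmx; [exact: has_deriv_on_cvg (d1 t tT)|exact: cvg_cst].
- move=> t tT; apply: cvg_addmx; first exact: cvg_cst.
  by apply: cvg_mulmx; [exact: cvg_cst|exact: has_deriv_on_cvg (d2 t tT)].
- by move=> t tT; mx_ring.
Qed.

(** The transpose solves the same equation with the same terminal value. *)
Lemma riccati_sym (n : nat) (A M Q : 'M[K]_n) (P : K -> 'M[K]_n) :
  M^T = M -> Q^T = Q -> (P T)^T = P T -> riccati_sol A M Q P ->
  forall t, 0 <= t <= T -> (P t)^T = P t.
Proof.
move=> Ms Qs PTs d.
apply: (@riccati_unique n A M Q (fun t => (P t)^T)) => // t tT.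
have := has_deriv_on_tr (d t tT); congr has_deriv_on.
rewrite !(trmxD, trmxN, trmx_mul, trmxK) Ms Qs.
by mx_ring.
Qed.

Lemma has_deriv_on_usubmx (m1 m2 n : nat) (f : K -> 'M[K]_(m1 + m2, n)) (t : K) l :
  has_deriv_on T f t l -> has_deriv_on T (fun s => usubmx (f s)) t (usubmx l).
Proof.
move=> /has_deriv_on_mxP fl; apply/has_deriv_on_mxP => i j; rewrite mxE.
by under eq_fun do rewrite mxE; exact: fl.
Qed.

Lemma has_deriv_on_dsubmx (m1 m2 n : nat) (f : K -> 'M[K]_(m1 + m2, n)) (t : K) l :
  has_deriv_on T f t l -> has_deriv_on T (fun s => dsubmx (f s)) t (dsubmx l).
Proof.
move=> /has_deriv_on_mxP fl; apply/has_deriv_on_mxP => i j; rewrite mxE.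
by under eq_fun do rewrite mxE; exact: fl.
Qed.

(* If [X t v = 0], then [(X v)^T (Y v)] is nonincreasing, zero at [t] and
   nonnegative at [T]; so it vanishes on `[t, T], which forces [M Y v = 0] there.
   Then [X v] solves [x' = A x] with [x t = 0], whence [v = X T v = 0]. *)
Lemma hamiltonian_unitmx (n : nat) (A M Q Qf : 'M[K]_n) (X Y : K -> 'M[K]_n) :
  sym_psd M -> sym_psd Q -> sym_psd Qf -> X T = 1%:M -> Y T = Qf ->
  (forall t, 0 <= t <= T -> has_deriv_on T X t (A *m X t - M *m Y t)) ->
  (forall t, 0 <= t <= T -> has_deriv_on T Y t (- (Q *m X t) - A^T *m Y t)) ->
  forall t, 0 <= t <= T -> X t \in unitmx.
Proof.
move=> Mp Qp Qfp XT YT Xd Yd t /andP[t0 tT].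
have /symmetricmxP Ms := Mp.1; have /symmetricmxP Qs := Qp.1.
rewrite -unitmx_tr unitmxE unitfE; apply/det0P => -[u u0 uX].
pose v := u^T; have Xv : X t *m v = 0.
  by apply: trmx_inj; rewrite trmx_mul trmxK uX linear0.
pose x s := X s *m v; pose y s := Y s *m v.
have xd s : 0 <= s <= T -> has_deriv_on T x s (A *m x s - M *m y s).
  move=> sT; have := has_deriv_on_mul (Xd s sT) (has_deriv_on_cst T v s).
  by rewrite mulmx0 addr0 mulmxBl -!mulmxA.
have yd s : 0 <= s <= T -> has_deriv_on T y s (- (Q *m x s) - A^T *m y s).
  move=> sT; have := has_deriv_on_mul (Yd s sT) (has_deriv_on_cst T v s).
  by rewrite mulmx0 addr0 mulmxBl mulNmx -!mulmxA.
pose f s := - ((x s)^T *m y s) 0 0.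
pose f' s := bilin (y s) M (y s) + bilin (x s) Q (x s).
have fd s : 0 <= s <= T -> has_deriv_on_real T f s (f' s).
  move=> sT; have := has_deriv_on_mul (has_deriv_on_tr (xd s sT)) (yd s sT).
  move/has_deriv_on_opp/has_deriv_on_mxP/(_ 0 0); rewrite /f.
  under eq_fun do rewrite mxE.
  congr has_deriv_on_real; rewrite /f' /bilin; move: (x s) (y s) => xs ys.
  rewrite !(trmxD, trmxN, trmx_mul) Ms !(mulmxDl, mulmxDr, mulNmx, mulmxN, mulmxA, opprD, opprK).
  rewrite !(addmxE, oppmxE).
  by ring.
have f'0 s : 0 <= f' s by rewrite addr_ge0 ?Mp.2 ?Qp.2.
have ft : f t = 0 by rewrite /f /x Xv linear0 mul0mx mxE oppr0.
have fT : f T <= 0.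
  by rewrite /f /x /y XT YT mul1mx oppr_le0 mulmxA; exact: Qfp.2.
have fmono a b : t <= a -> a <= b -> b <= T -> f a <= f b.
  move=> ta ab bT; apply: (@has_deriv_on_ge0_le _ T f f') => //.
    exact: le_trans ta.
  by move=> s /andP[as_ sb]; apply: fd; rewrite (le_trans t0 (le_trans ta as_)) (le_trans sb).
have f0 s : t <= s <= T -> f s = 0.
  move=> /andP[ts sT]; apply/eqP; rewrite eq_le -{2}ft fmono// andbT.
  by apply: le_trans fT; exact: fmono.
have My s : t < s < T -> M *m y s = 0.
  move=> /andP[ts sT]; apply: sym_psd_ker => //.
  have isd r : t < r < T -> is_derive r 1 f (f' r).
    move=> /andP[tr rT]; have r0 := le_lt_trans t0 tr.
    by apply: has_deriv_on_is_derive; [rewrite r0|apply: fd; rewrite !ltW].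
  (* As [f] vanishes throughout the interval, [s] is a maximum and the derivative there is 0; [f' s]
     is a sum of two nonnegative forms, so each of them is 0. *)
  have [_ f'sE] : is_derive s 1 f 0.
    apply: (@derive1_at_max K f t T) => //; rewrite ?in_itv /= ?ts//.
    - by move=> r; rewrite in_itv /= => /isd[].
    - move=> r; rewrite in_itv /= => /andP[tr rT].
      by rewrite !f0 ?(ltW tr) ?(ltW rT) ?(ltW ts) ?(ltW sT).
  have [|_ f'E] := isd s; first by rewrite ts.
  apply/eqP; rewrite eq_le Mp.2 andbT; have <- : f' s = 0 by rewrite -f'sE f'E.
  by rewrite lerDl Qp.2.
have xT0 : x T = 0.
  apply: (@linear_eq0 _ T _ _ (fun=> A) (fun=> 0) x (fun s => A *m x s - M *m y s) t T t) => //.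
  - by move=> s _; exact: cvg_cst.
  - by move=> s _; exact: cvg_cst.
  - by rewrite lexx.
  - by move=> s /andP[ts sT]; apply: xd; rewrite (le_trans t0).
  - by move=> s /My ->; rewrite subr0 mulmx0 addr0.
  by rewrite tT lexx.
move: u0; rewrite -trmx_eq0 -/v; apply/negP/negPn.
by rewrite -[v]mul1mx -XT -/(x T) xT0.
Qed.

Lemma riccati_exists (n : nat) (A M Q Qf : 'M[K]_n) :
  sym_psd M -> sym_psd Q -> sym_psd Qf ->
  exists P X : K -> 'M[K]_n, [/\ P T = Qf, riccati_sol A M Q P,
    forall t, 0 <= t <= T -> X t \in unitmx &
    forall t, 0 <= t <= T -> has_deriv_on T X t ((A - M *m P t) *m X t)].
Proof.
move=> Mp Qp Qfp.
(* The stacked matrix [(X, Y)] starts from [(1, Qf)] at time [T], so that [Y X^-1] equals [Qf]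
   there. *)
have [Z ZT Zd] := linear_cst_system (block_mx A (- M) (- Q) (- A^T)) T (col_mx 1%:M Qf).
pose X t := usubmx (Z t); pose Y t := dsubmx (Z t).
have ZE t : block_mx A (- M) (- Q) (- A^T) *m Z t
    = col_mx (A *m X t - M *m Y t) (- (Q *m X t) - A^T *m Y t).
  by rewrite -[Z t]vsubmxK mul_block_col !mulNmx.
have Xd t : 0 <= t <= T -> has_deriv_on T X t (A *m X t - M *m Y t).
  by move=> _; have := has_deriv_on_usubmx (Zd t); rewrite ZE col_mxKu.
have Yd t : 0 <= t <= T -> has_deriv_on T Y t (- (Q *m X t) - A^T *m Y t).
  by move=> _; have := has_deriv_on_dsubmx (Zd t); rewrite ZE col_mxKd.
have XT : X T = 1%:M by rewrite /X ZT col_mxKu.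
have YT : Y T = Qf by rewrite /Y ZT col_mxKd.
have XU := hamiltonian_unitmx Mp Qp Qfp XT YT Xd Yd.
exists (fun t => Y t *m invmx (X t)), X; split => //.
- by rewrite XT YT invmx1 mulmx1.
- move=> t tT; have := has_deriv_on_mul (Yd t tT) (has_deriv_on_inv tT XU (Xd t tT)).
  congr has_deriv_on; rewrite !(mulmxDl, mulmxDr, mulNmx, mulmxN) !mulmxA.
  rewrite -[Q *m X t *m _]mulmxA -[_ *m A *m X t *m _]mulmxA mulmxV ?XU// !mulmx1.
  by mx_ring.
- move=> t tT; rewrite mulmxBl -!mulmxA mulVmx ?XU// mulmx1.
  exact: Xd.
Qed.

End MatrixEquations.

(** * Algebraic decoupling of the right-hand sides *)

Section Decoupling.
Variables (K : realType) (n n1 : nat).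
Variables (A G Gam : 'M[K]_n) (B : 'M[K]_(n, n1)) (eta : 'cV[K]_n)
  (Q : 'M[K]_n) (R : 'M[K]_n1).
Variables (P Lam H : 'M[K]_n) (S theta : 'cV[K]_n).
Hypotheses (Ms : (BRB B R)^T = BRB B R) (Qs : Q^T = Q) (Ps : P^T = P)
  (Lams : Lam^T = Lam).

Local Notation M := (BRB B R).
Local Notation Pi := (P + Lam + H + H^T).
Local Notation Gam1 := (1%:M - Gam).

(** Transposes are pushed down to single matrices and removed from the symmetric ones, since
    [mx_ring] handles products and sums only. *)
Ltac mx_tr Ns :=
  rewrite ?(trmxD, trmxN, trmx_mul, trmxK, trmx1) ?Ns ?Qs ?Ps ?Lams.

(** The quadratic terms assemble into [Pi M Pi], and the source terms [- Q], [- Gam^T Q Gam],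
    [Q Gam] and [Gam^T Q] complete to a congruence of [Q], which is again semidefinite. *)
Lemma sum_rhs_riccati :
  rhs_P A B Q R P + rhs_Lam A G Gam B Q R P Lam H + rhs_H A G Gam B Q R P Lam H
    + (rhs_H A G Gam B Q R P Lam H)^T =
  - ((A + G)^T *m Pi) - Pi *m (A + G) + Pi *m M *m Pi - Gam1^T *m Q *m Gam1.
Proof.
rewrite /rhs_P /rhs_Lam /rhs_H /Acl.
(* [B R^-1 B^T] is generalised to a symmetric matrix [N], a single atom for the expansion. *)
move: (BRB B R) Ms => N Ns; mx_tr Ns; mx_ring.
Qed.

Lemma sum_rhs_linear :
  rhs_S A B eta Q R P H S theta + rhs_theta A G Gam B eta Q R P Lam H S theta =
  - ((A + G - M *m Pi)^T *m (S + theta)) + Gam1^T *m Q *m eta.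
Proof.
rewrite /rhs_S /rhs_theta /Acl.
move: (BRB B R) Ms => N Ns; mx_tr Ns; mx_ring.
Qed.

(** For known [P] and [Pi] this is affine in [H], and its two coefficients are the closed-loop
    matrices whose fundamental matrices come with the two Riccati solutions. *)
Lemma rhs_H_sylvester : rhs_H A G Gam B Q R P Lam H =
  - ((A - M *m P)^T *m H) - H *m (A + G - M *m Pi) + (Q *m Gam - P *m G).
Proof.
rewrite /rhs_H /Acl.
move: (BRB B R) Ms => N Ns; mx_tr Ns; mx_ring.
Qed.

Lemma rhs_S_sylvester : rhs_S A B eta Q R P H S theta =
  - ((A - M *m P)^T *m S) + (H *m M *m (S + theta) + Q *m eta).
Proof.
rewrite /rhs_S.
move: (BRB B R) Ms => N Ns; mx_tr Ns; mx_ring.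
Qed.

End Decoupling.

(** * Decoupled equations satisfied by a solution of the system *)

Section Solutions.
Variables (K : realType) (n n1 n2 n3 : nat).
Variables (A G Gam Gamf : 'M[K]_n) (B : 'M[K]_(n, n1)) (D : 'M[K]_(n, n2))
  (D0 : 'M[K]_(n, n3)) (eta etaf : 'cV[K]_n) (Q Qf : 'M[K]_n) (R : 'M[K]_n1).
Variable T : K.
Hypotheses (hQ : sym_psd Q) (hQf : sym_psd Qf) (hR : sym_pd R) (T0 : 0 < T).

Local Notation M := (BRB B R).
Local Notation Gam1 := (1%:M - Gam).
Local Notation Gamf1 := (1%:M - Gamf).
Local Notation is_sol := (is_solution A G Gam Gamf B D D0 eta etaf Q Qf R T).

Let Ms : M^T = M. Proof. exact/symmetricmxP/(BRB_psd B hR).1. Qed.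
Let Qs : Q^T = Q. Proof. exact/symmetricmxP/hQ.1. Qed.
Let Qfs : Qf^T = Qf. Proof. exact/symmetricmxP/hQf.1. Qed.

Section OneSolution.
Variables (P Lam H : K -> 'M[K]_n) (S theta : K -> 'cV[K]_n) (r : K -> K).
Hypothesis sol : is_sol P Lam H S theta r.

Let Ps t : 0 <= t <= T -> (P t)^T = P t.
Proof. by move=> tT; apply/symmetricmxP; exact: (sol_symP sol tT). Qed.

Let Lams t : 0 <= t <= T -> (Lam t)^T = Lam t.
Proof. by move=> tT; apply/symmetricmxP; exact: (sol_symLam sol tT). Qed.

Lemma sol_riccati :
  riccati_sol T (A + G) M (Gam1^T *m Q *m Gam1) (fun t => P t + Lam t + H t + (H t)^T).
Proof.
move=> t tT; rewrite -(sum_rhs_riccati A G Gam (H t) Ms Qs (Ps tT) (Lams tT)).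
apply: has_deriv_on_add; last exact: has_deriv_on_tr (sol_H sol tT).
apply: has_deriv_on_add; last exact: (sol_H sol tT).
by apply: has_deriv_on_add; [exact: (sol_P sol tT)|exact: (sol_Lam sol tT)].
Qed.

(** The term with the 1 by 1 zero matrix gives the vector equation the shape of a Sylvester
    equation, so that [sylvester_unique] applies. *)
Lemma sol_phi t : 0 <= t <= T ->
  has_deriv_on T (fun s => S s + theta s) t
    (- ((A + G - M *m (P t + Lam t + H t + (H t)^T))^T *m (S t + theta t))
     - (S t + theta t) *m 0 + Gam1^T *m Q *m eta).
Proof.
move=> tT; rewrite mulmx0 subr0 -(sum_rhs_linear A G Gam eta _ _ _ _ Ms (Ps tT) (Lams tT)).
by apply: has_deriv_on_add; [exact: (sol_S sol tT)|exact: (sol_theta sol tT)].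
Qed.

Lemma sol_H_sylvester t : 0 <= t <= T ->
  has_deriv_on T H t (- ((A - M *m P t)^T *m H t)
    - H t *m (A + G - M *m (P t + Lam t + H t + (H t)^T)) + (Q *m Gam - P t *m G)).
Proof.
by move=> tT; rewrite -(rhs_H_sylvester A G Gam _ _ _ Ms (Ps tT)); exact: (sol_H sol tT).
Qed.

Lemma sol_S_sylvester t : 0 <= t <= T ->
  has_deriv_on T S t (- ((A - M *m P t)^T *m S t) - S t *m 0
    + (H t *m M *m (S t + theta t) + Q *m eta)).
Proof.
move=> tT; rewrite mulmx0 subr0 -(rhs_S_sylvester A eta _ _ _ _ Ms (Ps tT)).
exact: (sol_S sol tT).
Qed.

Lemma sol_cont_P : cont_on T P.
Proof. exact: has_deriv_on_cont_on (fun t tT => sol_P sol tT). Qed.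

End OneSolution.

(** * Uniqueness for the coupled system *)

Lemma is_solution_unique (P Lam H : K -> 'M[K]_n) (S theta : K -> 'cV[K]_n) (r : K -> K)
    (P' Lam' H' : K -> 'M[K]_n) (S' theta' : K -> 'cV[K]_n) (r' : K -> K) :
  is_sol P Lam H S theta r -> is_sol P' Lam' H' S' theta' r' ->
  forall t, 0 <= t <= T ->
    [/\ P' t = P t, Lam' t = Lam t & H' t = H t] /\
    [/\ S' t = S t, theta' t = theta t & r' t = r t].
Proof.
move=> s s'.
pose Pi t := P t + Lam t + H t + (H t)^T.
have PE : forall t, 0 <= t <= T -> P' t = P t.
  apply: (riccati_unique T0 (sol_P s') (sol_P s)).
  by rewrite (sol_PT s) (sol_PT s').
have PiE : forall t, 0 <= t <= T -> P' t + Lam' t + H' t + (H' t)^T = Pi t.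
  apply: (riccati_unique T0 (sol_riccati s') (sol_riccati s)).
  by rewrite (sol_PT s) (sol_PT s') (sol_LamT s) (sol_LamT s') (sol_HT s) (sol_HT s').
have Pic : cont_on T Pi by exact: has_deriv_on_cont_on (sol_riccati s).
have A1c : cont_on T (fun t => A - M *m P t).
  move=> t tT; apply: cvg_addmx; first exact: cvg_cst.
  apply: cvg_oppmx; apply: cvg_mulmx; first exact: cvg_cst.
  exact: sol_cont_P s t tT.
have A2c : cont_on T (fun t => A + G - M *m Pi t).
  move=> t tT; apply: cvg_addmx; first exact: cvg_cst.
  by apply: cvg_oppmx; apply: cvg_mulmx; [exact: cvg_cst|exact: Pic].
have c0 k : cont_on T (fun=> 0 : 'M[K]_k) by move=> t _; exact: cvg_cst.
have HE : forall t, 0 <= t <= T -> H' t = H t.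
  apply: (sylvester_unique T0 A1c A2c _ _ (sol_H_sylvester s)).
    by rewrite (sol_HT s) (sol_HT s').
  (* Rewriting with the equalities already obtained gives both equations the same coefficients and
     source. *)
  by move=> t tT; have := sol_H_sylvester s' tT; rewrite (PiE t tT) (PE t tT).
have phiE : forall t, 0 <= t <= T -> S' t + theta' t = S t + theta t.
  apply: (sylvester_unique T0 A2c (c0 1%N) _ _ (sol_phi s)).
    by rewrite (sol_ST s) (sol_ST s') (sol_thetaT s) (sol_thetaT s').
  by move=> t tT; have := sol_phi s' tT; rewrite (PiE t tT).
have SE : forall t, 0 <= t <= T -> S' t = S t.
  apply: (sylvester_unique T0 A1c (c0 1%N) _ _ (sol_S_sylvester s)).
    by rewrite (sol_ST s) (sol_ST s').
  by move=> t tT; have := sol_S_sylvester s' tT; rewrite (phiE t tT) (PE t tT) (HE t tT).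
have LamE t : 0 <= t <= T -> Lam' t = Lam t.
  move=> tT; have := PiE t tT; rewrite /Pi PE// HE//.
  by move/addIr/addIr/addrI.
have thetaE t : 0 <= t <= T -> theta' t = theta t.
  by move=> tT; have := phiE t tT; rewrite SE//; exact: addrI.
have rE t : 0 <= t <= T -> r' t = r t.
  pose d u := rhs_r B D D0 eta Q R (P u) (Lam u) (H u) (S u) (theta u).
  (* Both functions now have the same derivative [d], so uniqueness applies with zero
     coefficients. *)
  move=> tT; have /matrixP/(_ 0 0) : (r' t)%:M = (r t)%:M :> 'M[K]_1.
    apply: (@has_deriv_on_uniq K T T0 1 1 (fun t => (r' t)%:M) (fun t => (r t)%:M)
      (fun t => (d t)%:M) (fun t => (d t)%:M) (fun=> 0) (fun=> 0)) => //.
    - by rewrite (sol_rT s) (sol_rT s').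
    - move=> u uT; apply/has_deriv_on_scalar; have := sol_r s' uT.
      by rewrite PE// LamE// HE// SE// thetaE.
    - by move=> u uT; apply/has_deriv_on_scalar; exact: (sol_r s uT).
    - by move=> u _; rewrite subrr mul0mx mulmx0 addr0.
  by rewrite !mxE.
by move=> t tT; split; split; auto.
Qed.

(** * Existence for the coupled system *)

Lemma is_solution_exists :
  exists (P Lam H : K -> 'M[K]_n) (S theta : K -> 'cV[K]_n) (r : K -> K),
    is_sol P Lam H S theta r.
Proof.
have Mp := BRB_psd B hR.
have [P [X [PT Pd XU Xd]]] := riccati_exists T A Mp hQ hQf.
(* The terminal values of [P], [Lam], [H] and [H^T] add up to [(1 - Gamf)^T Qf (1 - Gamf)], which is
   semidefinite as [riccati_exists] requires. *)
have [Pi [X2 [PiT Pid X2U X2d]]] := riccati_exists T (A + G) Mp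
  (sym_psd_congr Gam1 hQ) (sym_psd_congr Gamf1 hQf).
have Ps : forall t, 0 <= t <= T -> (P t)^T = P t.
  by apply: (riccati_sym T0 Ms Qs _ Pd); rewrite PT.
have Pis : forall t, 0 <= t <= T -> (Pi t)^T = Pi t.
  apply: (riccati_sym T0 Ms _ _ Pid); first exact/symmetricmxP/(sym_psd_congr _ hQ).1.
  by rewrite PiT; exact/symmetricmxP/(sym_psd_congr _ hQf).1.
have Pc : cont_on T P := has_deriv_on_cont_on Pd.
(* The constant 1 is a fundamental matrix for the zero coefficient on the right, which makes the
   vector equations instances of [sylvester_exists]. *)
have one_d (t : K) : 0 <= t <= T ->
    has_deriv_on T (fun=> 1%:M : 'M[K]_1) t ((fun=> 0) t *m 1%:M).
  by move=> _; rewrite mul0mx; exact: has_deriv_on_cst.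
have one_U (t : K) : 0 <= t <= T -> (fun=> 1%:M : 'M[K]_1) t \in unitmx.
  by move=> _; exact: unitmx1.
have [|H HT Hd] := sylvester_exists T0 (F := fun t => Q *m Gam - P t *m G)
    (- (Qf *m Gamf)) XU X2U Xd X2d.
  move=> t tT; apply: cvg_addmx; first exact: cvg_cst.
  by apply: cvg_oppmx; apply: cvg_mulmx; [exact: Pc|exact: cvg_cst].
have Hc : cont_on T H := has_deriv_on_cont_on Hd.
have [|phi phiT phid] := sylvester_exists T0 (F := fun=> Gam1^T *m Q *m eta)
    (- (Gamf1^T *m Qf *m etaf)) X2U one_U X2d one_d.
  by move=> t _; exact: cvg_cst.
have phic : cont_on T phi := has_deriv_on_cont_on phid.
have [|S ST Sd] := sylvester_exists T0 (F := fun t => H t *m M *m phi t + Q *m eta)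
    (- (Qf *m etaf)) XU one_U Xd one_d.
  move=> t tT; apply: cvg_addmx; last exact: cvg_cst.
  by apply: cvg_mulmx (phic t tT); apply: cvg_mulmx; [exact: Hc|exact: cvg_cst].
have Sc : cont_on T S := has_deriv_on_cont_on Sd.
(* With [Lam] and [theta] defined by subtraction, [Pi] and [phi] are the required sums at every [t],
   and the decoupled equations turn back into the original ones. *)
pose Lam t := Pi t - P t - H t - (H t)^T.
pose theta t := phi t - S t.
have sumE t : P t + Lam t + H t + (H t)^T = Pi t by rewrite /Lam; mx_ring.
have phiE t : S t + theta t = phi t by rewrite /theta addrC subrK.
have Lams t : 0 <= t <= T -> (Lam t)^T = Lam t.
  move=> tT; rewrite /Lam !(trmxD, trmxN) trmxK Ps// Pis//; exact: addrAC.
have Hd' t : 0 <= t <= T -> has_deriv_on T H t (rhs_H A G Gam B Q R (P t) (Lam t) (H t)).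
  by move=> tT; rewrite (rhs_H_sylvester A G Gam _ _ _ Ms (Ps t tT)) sumE; exact: Hd.
have Sd' t : 0 <= t <= T ->
    has_deriv_on T S t (rhs_S A B eta Q R (P t) (H t) (S t) (theta t)).
  move=> tT; rewrite (rhs_S_sylvester A eta _ _ _ _ Ms (Ps t tT)) phiE.
  by have := Sd t tT; rewrite mulmx0 subr0.
have Lamd t : 0 <= t <= T ->
    has_deriv_on T Lam t (rhs_Lam A G Gam B Q R (P t) (Lam t) (H t)).
  move=> tT; have := sum_rhs_riccati A G Gam (H t) Ms Qs (Ps t tT) (Lams t tT).
  rewrite sumE => e.
  (* The summed identity is solved for the right-hand side of [Lam]; what remains are the known
     derivatives of [Pi], [P], [H] and [H^T]. *)
  have -> : rhs_Lam A G Gam B Q R (P t) (Lam t) (H t) =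
      (- ((A + G)^T *m Pi t) - Pi t *m (A + G) + Pi t *m M *m Pi t - Gam1^T *m Q *m Gam1)
      - rhs_P A B Q R (P t) - rhs_H A G Gam B Q R (P t) (Lam t) (H t)
      - (rhs_H A G Gam B Q R (P t) (Lam t) (H t))^T.
    have addK (a b c d : 'M[K]_n) : b = a + b + c + d - a - c - d by mx_ring.
    by rewrite -e; exact: addK.
  apply: has_deriv_on_add; last exact/has_deriv_on_opp/has_deriv_on_tr/Hd'.
  apply: has_deriv_on_add; last exact/has_deriv_on_opp/Hd'.
  by apply: has_deriv_on_add; [exact: Pid|exact/has_deriv_on_opp/Pd].
have Lamc : cont_on T Lam := has_deriv_on_cont_on Lamd.
have thetad t : 0 <= t <= T -> has_deriv_on T theta t
    (rhs_theta A G Gam B eta Q R (P t) (Lam t) (H t) (S t) (theta t)).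
  move=> tT.
  have := sum_rhs_linear A G Gam eta Q (H t) (S t) (theta t) Ms (Ps t tT) (Lams t tT).
  rewrite sumE phiE => e.
  have -> : rhs_theta A G Gam B eta Q R (P t) (Lam t) (H t) (S t) (theta t) =
      (- ((A + G - M *m Pi t)^T *m phi t) + Gam1^T *m Q *m eta)
      - rhs_S A B eta Q R (P t) (H t) (S t) (theta t).
    by rewrite -e addrAC subrr add0r.
  apply: has_deriv_on_add; last exact/has_deriv_on_opp/Sd'.
  by have := phid t tT; rewrite mulmx0 subr0.
have thetac : cont_on T theta := has_deriv_on_cont_on thetad.
have bilin_c (u v : K -> 'cV[K]_n) (N : 'M[K]_n) : cont_on T u -> cont_on T v ->
    cont_on T (fun t => bilin (u t) N (v t)).
  move=> uc vc t tT; rewrite /bilin.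
  suff /cvg_mxP/(_ 0 0) : (fun s => (u s)^T *m N *m v s) @ within `[0, T] t^' -->
      (u t)^T *m N *m v t by [].
  apply: cvg_mulmx (vc t tT); apply: cvg_mulmx; last exact: cvg_cst.
  by apply: cvg_trmx; exact: uc.
have tr_c k (C : 'M[K]_(n, k)) (N : K -> 'M[K]_n) : cont_on T N ->
    cont_on T (fun t => \tr (N t *m C *m C^T)).
  move=> Nc t tT; apply: cvg_sumr => i.
  suff /cvg_mxP/(_ i i) : (fun s => N s *m C *m C^T) @ within `[0, T] t^' -->
      N t *m C *m C^T by [].
  by apply: cvg_mulmx; [apply: cvg_mulmx; [exact: Nc|exact: cvg_cst]|exact: cvg_cst].
(* The right-hand side for [r] does not contain [r], so its continuity is enough to obtain [r] as a
   primitive. *)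
have rc : cont_on T
    (fun t => rhs_r B D D0 eta Q R (P t) (Lam t) (H t) (S t) (theta t)).
  move=> t tT; apply: cvgB; last exact: cvg_cst.
  apply: cvgB; last exact: tr_c.
  apply: cvgB; last first.
    apply: (tr_c _ _ (fun s => P s + Lam s + H s + (H s)^T)) tT => u uT.
    apply: cvg_addmx; last by apply: cvg_trmx; exact: Hc.
    apply: cvg_addmx; last exact: Hc.
    by apply: cvg_addmx; [exact: Pc|exact: Lamc].
  apply: cvgD; first exact: bilin_c.
  have Stc : cont_on T (fun s => 2 *: S s + theta s).
    move=> u uT; apply: cvg_addmx; last exact: thetac.
    by apply: cvg_scalemx; [exact: cvg_cst|exact: Sc].
  exact: bilin_c thetac Stc t tT.
have [r rT rd] := cont_on_primitive (bilin etaf Qf etaf) T0 rc.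
exists P, Lam, H, S, theta, r; split.
- by move=> t tT; apply/symmetricmxP; exact: Ps.
- by move=> t tT; apply/symmetricmxP; exact: Lams.
- exact: Pd.
- exact: Lamd.
- exact: Hd'.
- exact: Sd'.
- exact: thetad.
- exact: rd.
- exact: PT.
- rewrite /Lam PiT PT HT.
  by rewrite !(trmxD, trmxN, trmx_mul, trmx1) Qfs; mx_ring.
- exact: HT.
- exact: ST.
- rewrite /theta phiT ST.
  by rewrite !(trmxD, trmxN, trmx1); mx_ring.
- exact: rT.
Qed.

End Solutions.

Theorem theorem5p1 (K : realType) (n n1 n2 n3 : nat)
    (A G Gam Gamf : 'M[K]_n) (B : 'M[K]_(n, n1)) (D : 'M[K]_(n, n2))
    (D0 : 'M[K]_(n, n3)) (eta etaf : 'cV[K]_n) (Q Qf : 'M[K]_n)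
    (R : 'M[K]_n1) (T : K)
    (hQ : sym_psd Q) (hQf : sym_psd Qf) (hR : sym_pd R) (hT : 0 < T) :
  exists (P Lam H : K -> 'M[K]_n) (S theta : K -> 'cV[K]_n) (r : K -> K),
    is_solution A G Gam Gamf B D D0 eta etaf Q Qf R T P Lam H S theta r /\
    forall (P' Lam' H' : K -> 'M[K]_n) (S' theta' : K -> 'cV[K]_n)
        (r' : K -> K),
      is_solution A G Gam Gamf B D D0 eta etaf Q Qf R T
        P' Lam' H' S' theta' r' ->
      forall t, 0 <= t <= T ->
        [/\ P' t = P t, Lam' t = Lam t & H' t = H t] /\
        [/\ S' t = S t, theta' t = theta t & r' t = r t].
Proof.
have [P [Lam [H [S [theta [r sol]]]]]] :=
  is_solution_exists A G Gam Gamf B D D0 eta etaf hQ hQf hR hT.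
exists P, Lam, H, S, theta, r; split=> // P' Lam' H' S' theta' r'.
exact: is_solution_unique.
Qed.
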